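(* Let $P$ be a nonempty finite poset with $n$ elements, and suppose the elements of $P$ are partitioned into $b$ bundles. Let $\pi(P)$ be the set of tubings of $P$, partially ordered by reverse containment (i.e. $T \le T'$ iff $T \supseteq T'$). Then there exists a convex polytope $\mathcal{K}P$ (the poset associahedron) of dimension $n-b$ whose poset of nonempty faces, ordered by inclusion, is isomorphic to $\pi(P)$.
   Context: For a finite poset $(P,\preceq)$: a lower set is a subset $L\subseteq P$ such that $y\preceq x\in L$ implies $y\in L$. The boundary of $x\in P$ is $\partial x=\{y\in P : y\prec x\}$. The bundle of $x$ is $\mathrm{bu}(x)=\{y\in P : \partial y=\partial x\}$; the bundles partition $P$. A subset of $P$ is connected if it induces a connected subgraph of the Hasse diagram of $P$. A lower set $L$ is filled if for every $x\in P$ with $\partial x\subseteq L$, we have $L\cap \mathrm{bu}(x)\neq\emptyset$. A tube is a filled, connected lower set. A tubing is a set $T$ of tubes, none equal to $P$, such that any two tubes of $T$ are either disjoint or nested (one contains the other), and such that the union of the tubes in every nonempty subset of $T$ is filled. (The empty set is a tubing.)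
   Formalization: A tubing is additionally required not to cover P (the union of all its tubes is not P). This is automatic for connected P; for every disconnected P the claim fails without it, e.g. two incomparable points give four tubings, but a segment has three nonempty faces. *)

(* Defs.v *)
From HB Require Import structures.
From mathcomp Require Import all_boot all_order all_algebra.

Set Implicit Arguments.
Unset Strict Implicit.
Unset Printing Implicit Defensive.

Import Order.TTheory GRing.Theory Num.Theory.

Section PosetTubings.
Context {disp : Order.disp_t} {P : finPOrderType disp}.
Implicit Types (x y : P) (A L : {set P}) (T : {set {set P}}).

Definition lower_set L :=
  [forall x in L, forall y, (y <= x)%O ==> (y \in L)].

Definition boundary x : {set P} := [set y | (y < x)%O].

Definition bundle x : {set P} := [set y | boundary y == boundary x].

Definition bundles : {set {set P}} := [set bundle x | x : P].

Definition covered x y := (x < y)%O && ~~ [exists z, (x < z < y)%O].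

Definition hasse_adj x y := covered x y || covered y x.

Definition hasse_in A : rel P :=
  [rel x y | [&& x \in A, y \in A & hasse_adj x y]].

(* The empty set counts as connected; this is immaterial for tubes, since the
   empty set is not filled in a nonempty poset. *)
Definition hasse_connected A :=
  [forall x in A, forall y in A, connect (hasse_in A) x y].

Definition filled L :=
  lower_set L &&
  [forall x, (boundary x \subset L) ==> (L :&: bundle x != set0)].

Definition tube L := filled L && hasse_connected L.

Definition pre_tubing T :=
  [&& [forall A in T, tube A && (A != setT)],
      [forall A in T, forall B in T,
         [|| [disjoint A & B], A \subset B | B \subset A]]
    & [forall S : {set {set P}},
         (S \subset T) && (S != set0) ==> filled (cover S)]].

(* The tubes of a tubing must not cover P.  For connected P this adds nothing to
   [pre_tubing], whose first clause already excludes P itself: see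
   [tubing_connected].  For disconnected P the clause is needed: no component
   of P equals P, and any [pre_tubing] stays one when a component is added to
   it, so [pre_tubing] alone never yields the face poset of a polytope.  For two
   incomparable points a, b it would allow all four subsets of {{a}, {b}}, while
   a segment has three nonempty faces. *)
Definition tubing T := pre_tubing T && (cover T != setT).

Lemma tubing_connected T :
  (0 < #|P|)%N -> hasse_connected setT -> tubing T = pre_tubing T.
Proof.
move=> /card_gt0P[x0 _] cP; rewrite /tubing; case: (boolP (pre_tubing T)) => //=.
case/and3P=> /forall_inP tT /forall_inP dT _.
apply/negP => /eqP covT.
have : x0 \in cover T by rewrite covT inE.
case/bigcupP=> A0 A0T x0A0.
case: (@arg_maxnP _ A0 (fun A => (A \in T) && (x0 \in A)) (fun A => #|A|)).
  by rewrite A0T.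
move=> A /andP[AT x0A] Amax.
case/andP: (tT _ AT) => _ /eqP; apply; apply/setP => y; rewrite inE.
have low B : B \in T -> forall u v : P, u \in B -> (v <= u)%O -> v \in B.
  move=> /tT/andP[/andP[/andP[/forall_inP lB _] _] _] u v /lB/forallP/(_ v).
  by move/implyP.
have clA : closed (hasse_in setT) (mem A).
  apply: intro_closed => [|u v].
    by apply: sym_connect_sym => u v; rewrite /hasse_in /= !in_setT /hasse_adj orbC.
  rewrite /hasse_in /= !in_setT /= => /orP[/andP[uv _]|/andP[vu _]] uA; last first.
    exact: low _ AT u v uA (ltW vu).
  have : v \in cover T by rewrite covT inE.
  case/bigcupP=> B BT vB; have uB := low _ BT _ _ vB (ltW uv).
  have /forall_inP/(_ B BT)/or3P[|/[dup] AB|/subsetP->//] := dT _ AT.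
    by rewrite disjoint_subset => /subsetP/(_ u uA); rewrite inE uB.
  move=> /subsetP/(_ x0 x0A) x0B.
  have /eqP-> // : A == B by rewrite eqEcard AB; apply: Amax; rewrite BT.
have /forall_inP/(_ x0 (in_setT _))/forall_inP/(_ y (in_setT _)) cxy := cP.
by rewrite -(closed_connect clA cxy).
Qed.

End PosetTubings.

Arguments bundles {disp} P.

Definition tubings {disp : Order.disp_t} (P : finPOrderType disp) :=
  {T : {set {set P}} | tubing T}.

Definition tubing_le {disp : Order.disp_t} {P : finPOrderType disp}
    (S T : tubings P) : Prop := sval T \subset sval S.

(* Imported only here: classical_sets shadows the finset names set0, setT. *)
From mathcomp Require Import boolp classical_sets reals.

Section Polytopes.
Context {R : realType} {d : nat}.
Local Open Scope ring_scope.
Local Open Scope classical_set_scope.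
Implicit Types (A K F : set 'rV[R]_d).

Definition conv {k : nat} (v : 'I_k -> 'rV[R]_d) : set 'rV[R]_d :=
  [set x | exists a : 'I_k -> R,
     [/\ forall i, 0 <= a i, \sum_i a i = 1 & x = \sum_i a i *: v i]].

Definition polytope K :=
  exists (k : nat) (v : 'I_k -> 'rV[R]_d), K = conv v.

Definition aff A : set 'rV[R]_d :=
  [set x | exists (k : nat) (v : 'I_k -> 'rV[R]_d) (a : 'I_k -> R),
     [/\ forall i, A (v i), \sum_i a i = 1 & x = \sum_i a i *: v i]].

(* The affine hull of A is a translate of a linear subspace of dimension m;
   this holds of no m when A is empty. *)
Definition affine_dim A (m : nat) :=
  exists (x0 : 'rV[R]_d) (U : {vspace 'rV[R]_d}),
    \dim U = m /\ aff A = [set x | x - x0 \in U].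

Definition dotv (c x : 'rV[R]_d) : R := \sum_i c 0 i * x 0 i.

(* c may be zero, so K itself (and the empty set) is a face. *)
Definition face K F :=
  exists (c : 'rV[R]_d) (b : R),
    (forall x, K x -> dotv c x <= b) /\ F = [set x | K x /\ dotv c x = b].

Definition nonempty_face K F := face K F /\ F !=set0.

Definition nonempty_faces K := {F : set 'rV[R]_d | nonempty_face K F}.

Definition face_le {K} (F G : nonempty_faces K) : Prop := sval F `<=` sval G.

End Polytopes.

Definition poset_iso (A B : Type) (leA : A -> A -> Prop)
    (leB : B -> B -> Prop) :=
  exists f : A -> B, bijective f /\ forall x y, leA x y <-> leB (f x) (f y).

(* Main.v *)
Require Import Defs.
From HB Require Import structures.
From mathcomp Require Import all_boot all_order all_algebra.
From mathcomp Require Import reals.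

(* Write 1_t for the indicator function of a tube t.  Modulo functions that are
   constant on bundles, every h : P -> R is represented by an H >= 0 with
   min H = 0 such that max_{bu(x)} H = min_{bd(x)} H for every non-minimal x; the
   nonempty superlevel sets {H >= k}, k > 0, are then filled lower sets, and
   their components are the tubes of a tubing T with H = sum_{t in T} lam_t 1_t,
   lam_t > 0.  So the cones spanned by the tubings form a complete simplicial fan.
   With the normalization H(p0) = 0 at a fixed minimal p0 instead of min H = 0,
   each coordinate H(p) is a concave piecewise linear function of h, being built
   from linear maps, minima and negated maxima; hence so is sum_S min_S H, where S
   ranges over the tubes and P itself.  This sum is linear exactly on the cones of
   the fan.  The polytope is the convex hull of the linear functionals obtained by
   choosing one argument in each of these minima and maxima, so that the minimum
   over it of the linear form h is this sum.  The face on which h is minimal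
   therefore depends only on T, and it is the intersection of the faces on which
   the 1_t, t in T, are minimal. *)

Set Implicit Arguments.
Unset Strict Implicit.
Unset Printing Implicit Defensive.

Import Order.TTheory GRing.Theory Num.Theory.

(** * Tubes, tubings and simultaneous choices of points *)

Section Tubings.
Context {disp : Order.disp_t} {P : finPOrderType disp}.
Implicit Types (x y p q r : P) (A L S t : {set P}) (T : {set {set P}}).

Lemma lower_setP L :
  reflect (forall x y, x \in L -> (y <= x)%O -> y \in L) (lower_set L).
Proof.
apply: (iffP forall_inP) => [lowL x y /lowL/forallP/(_ y)/implyP //|lowL x xL].
by apply/forallP => y; apply/implyP; apply: lowL.
Qed.

Lemma tube_lower t x y : tube t -> x \in t -> (y <= x)%O -> y \in t.
Proof. by case/andP=> /andP[/lower_setP low _] _; apply: low. Qed.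

Lemma in_boundary x y : (y \in boundary x) = (y < x)%O.
Proof. by rewrite inE. Qed.

Lemma in_bundle x y : (y \in bundle x) = (boundary y == boundary x).
Proof. by rewrite inE. Qed.

Lemma card_boundary_lt x y : y \in boundary x -> #|boundary y| < #|boundary x|.
Proof.
rewrite in_boundary => yx; apply: proper_card; apply/properP; split.
  by apply/subsetP => z; rewrite !in_boundary => /lt_trans->.
by exists y; rewrite in_boundary ?ltxx.
Qed.

Lemma lower_set_minimal L x :
  lower_set L -> x \in L -> exists2 p, p \in L & boundary p = set0.
Proof.
move=> /lower_setP lowL xL.
case: (arg_minnP (fun p => #|boundary p|) xL) => p pL pmin.
exists p => //; apply/eqP/set0Pn => -[y yp].
have := pmin y (lowL p y pL (ltW _)); rewrite -in_boundary => /(_ yp).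
by rewrite leqNgt card_boundary_lt.
Qed.

Lemma exists_minimal : (0 < #|P|)%N -> exists p, boundary p = set0.
Proof.
case/card_gt0P=> x _; have [|p _ p0] := @lower_set_minimal setT x _ (in_setT x).
  by apply/lower_setP => *; rewrite in_setT.
by exists p.
Qed.

Lemma tube_neq0 t : (0 < #|P|)%N -> tube t -> t != set0.
Proof.
move=> /exists_minimal[p p0] /andP[/andP[_ /forallP filt] _].
have := filt p; rewrite p0 sub0set => /set0Pn[y]; rewrite inE => /andP[yt _].
by apply/set0Pn; exists y.
Qed.

Lemma tubing_tube T t : tubing T -> t \in T -> tube t.
Proof. by case/andP=> /and3P[/forall_inP H _ _] _ /H /andP[]. Qed.

Lemma tubing_neqT T t : tubing T -> t \in T -> t != setT.
Proof. by case/andP=> /and3P[/forall_inP H _ _] _ /H /andP[]. Qed.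

Lemma tubing_nested T A B x : tubing T -> A \in T -> B \in T ->
  x \in A -> x \in B -> (A \subset B) || (B \subset A).
Proof.
case/andP=> /and3P[_ /forall_inP H _] _ AT BT xA xB.
have /forall_inP/(_ B BT)/or3P[|->//|->] := H A AT; last by rewrite orbT.
by rewrite disjoint_subset => /subsetP/(_ x xA); rewrite inE xB.
Qed.

Lemma tubing_filled T T' : tubing T -> T' \subset T -> T' != set0 ->
  filled (cover T').
Proof.
by case/andP=> /and3P[_ _ /forallP H] _ ? ?; apply: (implyP (H T')); apply/andP.
Qed.

Lemma tubing_chain_min T T' x : tubing T -> T' \subset T -> T' != set0 ->
  (forall t, t \in T' -> x \in t) ->
  exists2 t0, t0 \in T' & forall t, t \in T' -> t0 \subset t.
Proof.
move=> tT /subsetP sT /set0Pn[t1 t1T'] xT'.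
case: (arg_minnP (fun t => #|t|) t1T') => t0 t0T' t0min; exists t0 => // t tT'.
case/orP: (tubing_nested tT (sT _ t0T') (sT _ tT') (xT' _ t0T') (xT' _ tT')) => //.
by move=> tt0; rewrite -(eqP (_ : t == t0)) // eqEcard tt0 t0min.
Qed.

(** The tubes of [T] meeting [bundle x] all contain [boundary x], so they form a chain, and a bundle
    point of the smallest lies in all of them. The union of the other tubes, filled unless there are
    none, misses the bundle and therefore some [r] of the boundary. The chosen points attain the
    maximum over the bundle and the minimum over the boundary of all indicators of [T] at once. *)
Lemma tubing_bundle_choice T x : tubing T -> boundary x != set0 ->
  exists y r, [/\ y \in bundle x, r \in boundary x &
                 forall t, t \in T -> (y \in t) = (r \in t)].
Proof.
move=> tT /set0Pn[z zx].
have low t y r : t \in T -> y \in bundle x -> y \in t -> r \in boundary x ->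
    r \in t.
  move=> /(tubing_tube tT) tt; rewrite in_bundle => /eqP <- yt.
  by rewrite in_boundary => /ltW; apply: tube_lower.
pose T1 := [set t in T | t :&: bundle x != set0].
pose T0 := T :\: T1.
have [y yx yT1] : exists2 y, y \in bundle x & forall t, t \in T1 -> y \in t.
  have [->|T1n0] := eqVneq T1 set0.
    by exists x => [|t]; rewrite ?in_bundle // inE.
  have sT1 : T1 \subset T by apply/subsetP => t; rewrite inE => /andP[].
  have [|t0] := @tubing_chain_min _ _ z tT sT1 T1n0.
    move=> t; rewrite inE => /andP[tT' /set0Pn[y]]; rewrite inE => /andP[yt yx].
    exact: low tT' yx yt zx.
  rewrite inE => /andP[_ /set0Pn[y]]; rewrite inE => /andP[yt0 yx] t0min.
  by exists y => // t /t0min/subsetP->.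
have [r rx rT0] : exists2 r, r \in boundary x & forall t, t \in T0 -> r \notin t.
  have [->|T0n0] := eqVneq T0 set0; first by exists z => // t; rewrite inE.
  have /andP[_ /forallP/(_ x)] := tubing_filled tT (subsetDl T T1) T0n0.
  have [_|/subsetPn[r rx rcov] _] := boolP (_ \subset _).
    move=> /set0Pn[y']; rewrite inE => /andP[/bigcupP[t]].
    rewrite !inE => /andP[]; case tT': (t \in T) => //= + _ y't y'x.
    by case/set0Pn; exists y'; rewrite !inE y't.
  exists r => // t tT0; apply: contra rcov => rt; apply/bigcupP; exists t => //.
exists y, r; split=> // t tT'; case: (boolP (t \in T1)) => tT1.
  by rewrite (yT1 _ tT1) (low t y r tT' yx (yT1 _ tT1) rx).
rewrite (negPf (rT0 _ _)) ?inE ?tT' ?andbT //; last by rewrite inE tT' in tT1.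
apply: contraNF tT1 => yt; rewrite inE tT' /=.
by apply/set0Pn; exists y; rewrite inE yt.
Qed.

(** A point of [S] outside every tube of [T] that does not contain [S] is as required. If those
    tubes covered [S], a largest one through a point of [S] would be closed under Hasse adjacency in
    [S], so it would contain [S]. *)
Lemma tubing_connected_choice T S : tubing T -> S != set0 -> hasse_connected S ->
  exists2 q, q \in S & forall t, t \in T -> (q \in t) = (S \subset t).
Proof.
move=> tT /set0Pn[x xS] /forall_inP cS.
pose T' := [set t in T | ~~ (S \subset t)].
have [Scov|/subsetPn[q qS qT']] := boolP (S \subset cover T'); last first.
  exists q => // t tT'; have [/subsetP->//|nSt] := boolP (S \subset t).
  apply: contraNF qT' => qt; apply/bigcupP; exists t => //.
  by rewrite inE tT' nSt.
have /bigcupP[t1 t1T' xt1] := subsetP Scov x xS.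
have Q1 : (t1 \in T') && (x \in t1) by rewrite t1T'.
have [t /andP[tT' xt] tmax] :=
  arg_maxnP (P := fun t => (t \in T') && (x \in t)) (fun t => #|t|) Q1.
move: (tT'); rewrite inE => /andP[tT0 /subsetPn[y yS]].
(* A step down stays in the lower set [t]. For a step up from [u] to [v], a tube of [T'] through [v]
   also contains [u], so it is nested with [t] and, by maximality, lies inside it. *)
have clt : closed (hasse_in S) (mem t).
  apply: intro_closed => [|u v].
    by apply: sym_connect_sym => u v; rewrite /hasse_in /= /hasse_adj andbCA orbC.
  rewrite /hasse_in /= => /and3P[uS vS /orP[|]] /andP[uv _] ut; last first.
    exact: tube_lower (tubing_tube tT tT0) ut (ltW uv).
  have /bigcupP[t' t'T' vt'] := subsetP Scov v vS.
  move: (t'T'); rewrite inE => /andP[t'T0 _].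
  have ut' := tube_lower (tubing_tube tT t'T0) vt' (ltW uv).
  case/orP: (tubing_nested tT t'T0 tT0 ut' ut) => [/subsetP->//|tt'].
  have -> // : t = t'.
  by apply/eqP; rewrite eqEcard tt'; apply: tmax; rewrite t'T' (subsetP tt').
have /forall_inP/(_ y yS) cxy := cS x xS.
have : (x \in t) = (y \in t) := closed_connect clt cxy.
by rewrite xt => <-.
Qed.

Lemma tubing_uncovered T : tubing T -> exists q, forall t, t \in T -> q \notin t.
Proof.
case/andP=> _; rewrite -subTset => /subsetPn[q _ qT]; exists q => t tT.
by apply: contra qT => qt; apply/bigcupP; exists t.
Qed.

Definition tube_or_all S := tube S || (S == setT).

Lemma tubing_choice T S : (0 < #|P|)%N -> tubing T -> tube_or_all S ->
  exists2 q, q \in S & forall t, t \in T -> (q \in t) = (S \subset t).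
Proof.
move=> P0 tT /orP[tS|/eqP->].
  by apply: tubing_connected_choice; rewrite ?(tube_neq0 P0 tS) //; case/andP: tS.
have [q qT] := tubing_uncovered tT; exists q; rewrite ?inE // => t tT'.
by rewrite (negPf (qT t tT')) subTset (negPf (tubing_neqT tT tT')).
Qed.

(** Supplies a choice that is optimal for [T] but not for [t0]. The point [q] comes from the choice
    lemma applied to [t0] itself; [S] is the least tube of [T] containing [t0], or [P] if there is
    none, so that [S] and [t0] lie in the same tubes of [T]. *)
Lemma tubing_separation T t0 : (0 < #|P|)%N ->
  tubing T -> tube t0 -> t0 != setT -> t0 \notin T ->
  exists S q, [/\ tube_or_all S, q \in S,
    forall t, t \in T -> (q \in t) = (S \subset t), q \in t0 & ~~ (S \subset t0)].
Proof.
move=> P0 tT tt0 t0P t0T; have t0n0 := tube_neq0 P0 tt0.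
have [|q qt0 qT] := tubing_connected_choice tT t0n0; first by case/andP: tt0.
pose T' := [set t in T | t0 \subset t].
have [T'0|T'n0] := eqVneq T' set0.
  exists setT, q; rewrite /tube_or_all eqxx orbT inE subTset; split=> // t tT'.
  rewrite qT // subTset (negPf (tubing_neqT tT tT')).
  apply: contra_eqF T'0 => t0t; apply/set0Pn.
  by exists t; rewrite inE tT'.
have [||s] := @tubing_chain_min T T' q tT _ T'n0.
- by apply/subsetP => t; rewrite inE => /andP[].
- by move=> t; rewrite inE => /andP[_ /subsetP->].
rewrite inE => /andP[sT t0s] smin; exists s, q; split=> //.
- by rewrite /tube_or_all (tubing_tube tT sT).
- exact: (subsetP t0s).
- move=> t tT'; rewrite qT //; apply/idP/idP => [t0t|]; last exact: subset_trans.
  by apply: smin; rewrite inE tT'.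
- apply: contra t0T => st0; rewrite (eqP (_ : t0 == s)) //.
  by rewrite eqEsubset t0s.
Qed.

End Tubings.

(** * Connected components of lower sets *)

Section Components.
Context {disp : Order.disp_t} {P : finPOrderType disp}.
Implicit Types (x y p q u v : P) (A C L S : {set P}).

Definition component L p : {set P} :=
  [set q in L | connect (hasse_in L) p q].

Lemma hasse_in_connect_sym L : connect_sym (hasse_in L).
Proof.
by apply: sym_connect_sym => u v; rewrite /hasse_in /= /hasse_adj andbCA orbC.
Qed.

(** Descent along Hasse edges: an element of the interval from [v] up to but excluding [u] with
    largest boundary is covered by [u]. *)
Lemma lower_set_connect L u v :
  lower_set L -> u \in L -> (v <= u)%O -> connect (hasse_in L) u v.
Proof.
move=> /lower_setP lowL; have [n] := ubnP #|boundary u|.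
elim: n u => // n IHn u; rewrite ltnS => un uL; rewrite le_eqVlt.
case/predU1P => [->//|vu].
have Qv : (v <= v < u)%O by rewrite lexx.
have [w /andP[vw wu] wmax] :=
  arg_maxnP (P := fun w => (v <= w < u)%O) (fun w => #|boundary w|) Qv.
have wL := lowL _ _ uL (ltW wu).
apply: (@connect_trans _ _ w); last first.
  by apply: IHn => //; apply: leq_trans un; rewrite card_boundary_lt ?in_boundary.
apply: connect1; rewrite /hasse_in /= uL wL /hasse_adj /covered wu /=.
apply/orP; right; apply/existsP => -[z /andP[wz zu]].
have /= := wmax z; rewrite (ltW (le_lt_trans vw wz)) zu => /(_ isT).
by apply/negP; rewrite -ltnNge card_boundary_lt ?in_boundary.
Qed.

Lemma component_id L p : p \in L -> p \in component L p.
Proof. by rewrite inE => ->; rewrite connect0. Qed.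

Lemma component_sub L p : component L p \subset L.
Proof. by apply/subsetP => q; rewrite inE => /andP[]. Qed.

Lemma component_absorb L S p q : S \subset L -> hasse_connected S ->
  q \in S -> q \in component L p -> S \subset component L p.
Proof.
move=> /subsetP SL /forall_inP/(_ q) cS qS; rewrite inE => /andP[_ pq].
apply/subsetP => v vS; rewrite inE SL //=; apply: connect_trans pq _.
have /forall_inP/(_ v vS) := cS qS; apply: connect_sub => x y.
by case/and3P=> /SL xL /SL yL xy; apply: connect1; apply/and3P.
Qed.

Lemma component_connected L p : p \in L -> hasse_connected (component L p).
Proof.
move=> pL; pose C := component L p.
suff pC q : q \in C -> connect (hasse_in C) p q.
  apply/forall_inP => u uC; apply/forall_inP => v vC.
  by apply: connect_trans (pC v vC); rewrite hasse_in_connect_sym pC.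
rewrite inE => /andP[_ pq].
(* Reachability from [p] inside [C] is preserved by edges of [L], so a path in [L] yields one in
   [C]. *)
pose a : {pred P} := [pred v | connect (hasse_in C) p v].
have cla : closed (hasse_in L) a.
  apply: intro_closed => [|u v]; first exact: hasse_in_connect_sym.
  move=> uv; rewrite !inE => pu; apply: (connect_trans pu); apply: connect1.
  case/and3P: (uv) => uL vL adj.
  have uC : u \in C.
    have [->|pu'] := eqVneq u p; first exact: component_id.
    case/connectP: (pu) => s; case/lastP: s => [_ up|s w].
      by rewrite up eqxx in pu'.
    by rewrite rcons_path last_rcons => /andP[_ /and3P[_ wC _]] ->.
  apply/and3P; split=> //; move: uC; rewrite !inE vL => /andP[_ pu'] /=.
  by apply: connect_trans pu' _; apply: connect1.
have := closed_connect cla pq; rewrite !inE connect0 => /esym; exact.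
Qed.

(** An element of [L] in the bundle of [x] lies above every element of [boundary x], hence in the
    same component; for minimal [x] any minimal element of the component serves. *)
Lemma component_tube L p : filled L -> p \in L -> tube (component L p).
Proof.
move=> /andP[lowL /forallP filL] pL; rewrite /tube component_connected // andbT.
have lowC : lower_set (component L p).
  apply/lower_setP => u v; rewrite !inE => /andP[uL pu] vu.
  rewrite (lower_setP _ lowL u v uL vu) /=; apply: connect_trans pu _.
  exact: lower_set_connect.
rewrite /filled lowC; apply/forallP => x; apply/implyP => xC.
have [x0|/set0Pn[z zx]] := eqVneq (boundary x) set0.
  have [q qC q0] := lower_set_minimal lowC (component_id pL).
  by apply/set0Pn; exists q; rewrite inE qC in_bundle q0 x0 /=.
have /set0Pn[y] := implyP (filL x) (subset_trans xC (component_sub L p)).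
rewrite inE in_bundle => /andP[yL /eqP yx].
apply/set0Pn; exists y; rewrite inE in_bundle yx eqxx andbT inE yL /=.
have := subsetP xC z zx; rewrite inE => /andP[zL pz].
apply: connect_trans pz _; rewrite hasse_in_connect_sym lower_set_connect //.
by rewrite ltW // -in_boundary yx.
Qed.

End Components.

(** * Balanced functions *)

Section Decomposition.
Context {disp : Order.disp_t} {P : finPOrderType disp} {R : realFieldType}.
Implicit Types (x y p q r : P) (t : {set P}) (h H : P -> R).
Local Open Scope ring_scope.

(** Encodes that the maximum of [H] over [bundle x] equals its minimum over [boundary x]. Naming
    points that attain them makes the property stable under monotone changes of [H]. *)
Definition balanced_at H x := exists y r,
  [/\ y \in bundle x, r \in boundary x, H y = H r,
     (forall y', y' \in bundle x -> H y' <= H y)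
   & (forall r', r' \in boundary x -> H r <= H r')].

Definition balanced H := forall x, boundary x != set0 -> balanced_at H x.

Lemma exists_argmin (I : finType) (A : {set I}) (F : I -> R) : A != set0 ->
  exists2 i, i \in A & forall j, j \in A -> F i <= F j.
Proof.
case/set0Pn=> i0 Ai0; case: (Order.TotalTheory.arg_minP F Ai0) => i Ai Fi.
by exists i.
Qed.

Lemma exists_argmax (I : finType) (A : {set I}) (F : I -> R) : A != set0 ->
  exists2 i, i \in A & forall j, j \in A -> F j <= F i.
Proof.
move=> /(exists_argmin (fun i => - F i))[i Ai Fi]; exists i => // j /Fi.
by rewrite lerN2.
Qed.

Lemma bundle_id x : x \in bundle x. Proof. by rewrite in_bundle. Qed.

(** The shift of a bundle is determined by the values at elements with smaller boundary, so the
    shifts are found by induction on the size of the boundary. *)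
Lemma exists_balanced h : (0 < #|P|)%N -> exists C : {set P} -> R,
  let H p := h p + C (boundary p) in
  [/\ balanced H, forall p, 0 <= H p & exists p, H p = 0].
Proof.
move=> P_gt0.
have step k : exists C : {set P} -> R, forall x, boundary x != set0 ->
    (#|boundary x| < k)%N -> balanced_at (fun p => h p + C (boundary p)) x.
  elim: k => [|k [C IHC]]; first by exists (fun=> 0).
  pose H p := h p + C (boundary p).
  have ex_v (B : {set P}) : exists v : R, forall x, boundary x = B ->
      B != set0 -> exists y r,
      [/\ y \in bundle x, r \in B, h y + v = H r,
         (forall y', y' \in bundle x -> h y' <= h y)
       & (forall r', r' \in B -> H r <= H r')].
    have [[x /eqP xB]|nB] :=
      altP (@existsP _ (fun x => boundary x == B)); last first.
      by exists 0 => x xB; case/existsP: nB; exists x; rewrite xB.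
    have [->|Bn0] := eqVneq B set0; first by exists 0 => x' _ /eqP.
    have [r rB rmin] := exists_argmin H Bn0.
    have [|y yx ymax] := @exists_argmax _ (bundle x) h.
      by apply/set0Pn; exists x; apply: bundle_id.
    exists (H r - h y) => x' x'B _; exists y, r.
    have -> : bundle x' = bundle x by rewrite /bundle x'B xB.
    by split; rewrite // subrKC.
  have [v vP] := fin_all_exists ex_v.
  (* Shifts for boundaries of size below [k] are kept; the new ones are correct at size [k], and
     later stages replace those at larger sizes. *)
  exists (fun B : {set P} => if (#|B| < k)%N then C B else v B) => x xn0 xk.
  pose H' p := h p + (if (#|boundary p| < k)%N then C (boundary p)
                      else v (boundary p)).
  have eqH r : r \in boundary x -> H' r = H r.
    move=> /card_boundary_lt rx; rewrite /H'.
    by rewrite (leq_trans rx) // -ltnS.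
  have eqB y : y \in bundle x -> boundary y = boundary x.
    by rewrite in_bundle => /eqP.
  rewrite -/H'; have [lxk|lkx] := ltnP #|boundary x| k.
    have [y [r [yx rx Hyr ymax rmin]]] := IHC x xn0 lxk.
    have eqH1 y' : y' \in bundle x -> H' y' = H y'.
      by move=> /eqB y'x; rewrite /H' y'x lxk /H y'x.
    exists y, r; split=> //; first by rewrite eqH1 // eqH.
      by move=> y' y'x; rewrite !eqH1 //; apply: ymax.
    by move=> r' r'x; rewrite !eqH //; apply: rmin.
  have [y [r [yx rx Hyr ymax rmin]]] := vP _ x erefl xn0.
  have eqH1 y' : y' \in bundle x -> H' y' = h y' + v (boundary x).
    by move=> /eqB y'x; rewrite /H' y'x ltnNge lkx.
  exists y, r; split=> //; first by rewrite eqH1 // eqH.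
    by move=> y' y'x; rewrite !eqH1 // lerD2r; apply: ymax.
  by move=> r' r'x; rewrite !eqH //; apply: rmin.
have [C balC] := step #|P|.+1.
have [|p _ pmin] := @exists_argmin _ setT (fun p => h p + C (boundary p)).
  by case/card_gt0P: P_gt0 => x _; apply/set0Pn; exists x; rewrite inE.
(* A global constant brings the minimum to 0 and preserves balance. *)
exists (fun B : {set P} => C B - (h p + C (boundary p))); split=> [x xn0|q|].
- have [|y [r [yx rx Hyr ymax rmin]]] := balC x xn0; first by rewrite ltnS max_card.
  exists y, r; split=> //; first by rewrite !addrA Hyr.
    by move=> y' y'x; rewrite !addrA lerD2r ymax.
  by move=> r' r'x; rewrite !addrA lerD2r rmin.
- by rewrite addrA subr_ge0 pmin // inE.
- by exists p; rewrite addrA subrr.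
Qed.

Lemma balanced_antitone H x y : balanced H -> (x < y)%O -> H y <= H x.
Proof.
move=> bal; rewrite -in_boundary => xy.
have /bal[z [r [_ _ eq_zr zmax rmin]]] : boundary y != set0.
  by apply/set0Pn; exists x.
by rewrite (le_trans (zmax y _)) ?in_bundle // eq_zr rmin.
Qed.

Lemma tubing0 : (0 < #|P|)%N -> tubing (set0 : {set {set P}}).
Proof.
case/card_gt0P=> x _; apply/andP; split.
  apply/and3P; split.
  - by apply/forall_inP => A; rewrite inE.
  - by apply/forall_inP => A; rewrite inE.
  - by apply/forallP => S; rewrite subset0 andbN.
rewrite /cover big_set0 eq_sym; apply/eqP => /setP/(_ x).
by rewrite !inE.
Qed.

Lemma balanced_support_filled H : balanced H -> (exists p, 0 < H p) ->
  filled [set p | 0 < H p].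
Proof.
move=> bal [p Hp].
have low : lower_set [set p | 0 < H p].
  apply/lower_setP => x y; rewrite !inE => Hx; rewrite le_eqVlt.
  by case/predU1P=> [->//|/(balanced_antitone bal)]; apply: lt_le_trans.
rewrite /filled low; apply/forallP => x; apply/implyP => xL.
have [x0|xn0] := eqVneq (boundary x) set0.
  have [|q qL q0] := @lower_set_minimal _ _ _ p low; first by rewrite inE.
  by apply/set0Pn; exists q; rewrite inE qL in_bundle q0 x0 /=.
have [y [r [yx rx Hyr _ _]]] := bal x xn0.
apply/set0Pn; exists y; rewrite inE yx andbT inE Hyr.
by have := subsetP xL r rx; rewrite inE.
Qed.

End Decomposition.

(** * Adjoining the components of a filled set to a tubing *)

Section Adjoin.
Context {disp : Order.disp_t} {P : finPOrderType disp}.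
Implicit Types (x y p q r : P) (t A L : {set P}) (T : {set {set P}}).

Definition components L : {set {set P}} := [set component L p | p in L].

Lemma tube_component_dichotomy L A C : tube A -> A \subset L ->
  C \in components L -> [disjoint A & C] || (A \subset C).
Proof.
move=> /andP[_ cA] AL /imsetP[p pL ->].
have [//|/pred0Pn[q /andP[/= qA qC]]] := boolP [disjoint A & _].
by rewrite (component_absorb AL cA qA qC).
Qed.

(** The delicate point is that unions are filled. Let a nonempty [boundary x] be covered by [S]. As
    [L] is filled, it contains some [y] in [bundle x], and the component [C] of [y] in [L] contains
    [boundary x]. Either [C] is in [S] and covers [y], or the members of [S] inside [C] cover
    [boundary x], belong to [T], and so have a filled union. *)
Lemma tubing_adjoin_components T L : (0 < #|P|)%N -> tubing T ->
  (forall t, t \in T -> t \subset L) -> filled L -> L != setT ->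
  tubing (T :|: components L).
Proof.
move=> P_gt0 tT TL filL LT; set U := T :|: _.
have tubeC C : C \in components L -> tube C.
  by case/imsetP=> p pL ->; apply: component_tube.
have tubeU A : A \in U -> tube A.
  by rewrite inE => /orP[/(tubing_tube tT)|/tubeC].
have UL A : A \in U -> A \subset L.
  by rewrite inE => /orP[/TL//|/imsetP[p pL ->]]; apply: component_sub.
have neqT A : A \subset L -> A != setT.
  by apply: contraTneq => ->; rewrite subTset.
have dich A C : A \in U -> C \in components L -> [disjoint A & C] || (A \subset C).
  by move=> AU; apply: tube_component_dichotomy; rewrite ?tubeU ?UL.
apply/andP; split; last first.
  by apply: neqT; apply/bigcupsP => A; apply: UL.
apply/and3P; split.
- by apply/forall_inP => A AU; rewrite tubeU // neqT // UL.
- apply/forall_inP => A AU; apply/forall_inP => B BU.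
  have [BC|nBC] := boolP (B \in components L).
    by have /orP[->|->] := dich A B AU BC; rewrite ?orbT.
  have [AC|nAC] := boolP (A \in components L).
    by have /orP[|->] := dich B A BU AC; rewrite ?orbT // disjoint_sym => ->.
  have AT : A \in T by move: AU; rewrite inE (negPf nAC) orbF.
  have BT : B \in T by move: BU; rewrite inE (negPf nBC) orbF.
  have [//|/pred0Pn[q /andP[/= qA qB]]] := boolP [disjoint A & B].
  exact: tubing_nested tT AT BT qA qB.
apply/forallP => S; apply/implyP => /andP[/subsetP SU /set0Pn[A0 A0S]].
have lowS : lower_set (cover S).
  apply/lower_setP => x y /bigcupP[A AS xA] yx; apply/bigcupP; exists A => //.
  exact: tube_lower (tubeU A (SU A AS)) xA yx.
rewrite /filled lowS; apply/forallP => x; apply/implyP => xS.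
have [x0|/set0Pn[z zx]] := eqVneq (boundary x) set0.
  have /set0Pn[a aA0] := tube_neq0 P_gt0 (tubeU A0 (SU A0 A0S)).
  have [|q qS q0] := @lower_set_minimal _ _ _ a lowS.
    by apply/bigcupP; exists A0.
  by apply/set0Pn; exists q; rewrite inE qS in_bundle q0 x0 /=.
have SL : cover S \subset L by apply/bigcupsP => A /SU/UL.
have xL := subset_trans xS SL.
case/andP: (filL) => lowL /forallP/(_ x); rewrite xL => /set0Pn[y].
rewrite inE in_bundle => /andP[yL /eqP yx].
have zL := subsetP xL z zx.
pose C := component L z; have CL : C \in components L by apply: imset_f.
have yC : y \in C.
  rewrite inE yL hasse_in_connect_sym lower_set_connect //.
  by rewrite ltW // -in_boundary yx.
have [CS|nCS] := boolP (C \in S).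
  apply/set0Pn; exists y; rewrite inE in_bundle yx eqxx andbT.
  by apply/bigcupP; exists C.
have xC w : w \in boundary x -> w \in C.
  rewrite -yx in_boundary => /ltW; exact: tube_lower (tubeC C CL) yC.
pose S' := [set A in S | A \subset C].
have xS' : boundary x \subset cover S'.
  apply/subsetP => w wx; have /bigcupP[A AS wA] := subsetP xS w wx.
  apply/bigcupP; exists A => //; rewrite inE AS /=.
  case/orP: (dich A C (SU A AS) CL) => //.
  by rewrite disjoint_subset => /subsetP/(_ w wA); rewrite inE xC.
have S'T : S' \subset T.
  apply/subsetP => A; rewrite inE => /andP[AS AC].
  have := SU A AS; rewrite inE => /orP[//|AL].
  case/negP: nCS; rewrite (_ : C = A) //; apply/eqP.
  rewrite eqEsubset AC andbT.
  have /set0Pn[a aA] := tube_neq0 P_gt0 (tubeC A AL).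
  have CU : C \in U by rewrite inE CL orbT.
  case/orP: (dich C A CU AL) => //.
  rewrite disjoint_sym disjoint_subset => /subsetP/(_ a aA).
  by rewrite inE (subsetP AC).
have S'0 : S' != set0.
  have /bigcupP[A AS' _] := subsetP xS' z zx.
  by apply/set0Pn; exists A.
have /andP[_ /forallP/(_ x)] := tubing_filled tT S'T S'0.
rewrite xS' => /set0Pn[y']; rewrite inE => /andP[/bigcupP[A]].
rewrite inE => /andP[AS _] y'A y'x; apply/set0Pn; exists y'.
by rewrite inE y'x andbT; apply/bigcupP; exists A.
Qed.

Lemma component_unique L p C : C \in components L -> p \in L ->
  (p \in C) = (C == component L p).
Proof.
case/imsetP=> q qL -> pL; apply/idP/eqP => [|->]; last exact: component_id.
rewrite inE => /andP[_ qp]; apply/setP => v; rewrite !inE.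
by rewrite (same_connect (hasse_in_connect_sym L) qp).
Qed.

End Adjoin.

(** * Decomposition into indicators of tubes *)

Section LayerCake.
Context {disp : Order.disp_t} {P : finPOrderType disp} {R : realFieldType}.
Implicit Types (x y p q r : P) (t : {set P}) (h H : P -> R).
Local Open Scope ring_scope.

Lemma sum_components (L : {set P}) p :
  \sum_(t in components L) (p \in t)%:R = (p \in L)%:R :> R.
Proof.
have [pL|npL] := boolP (p \in L); last first.
  rewrite big1 // => C /imsetP[q _ ->].
  by rewrite (negPf (contra (subsetP (component_sub L q) p) npL)).
rewrite (bigD1 (component L p)) ?imset_f //= component_id // big1 ?addr0 //.
by move=> C /andP[CL nC]; rewrite (component_unique CL pL) (negPf nC).
Qed.

(* Layer cake: peel off the lowest positive layer of H, which is constant on the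
   support of H, and split that support into its components. *)
Lemma balanced_decomposition H : (0 < #|P|)%N -> balanced H ->
  (forall p, 0 <= H p) -> (exists p, H p = 0) ->
  exists lam : {set P} -> R,
    [/\ forall t, 0 <= lam t, tubing [set t | 0 < lam t]
      & forall p, H p = \sum_t lam t * (p \in t)%:R].
Proof.
move=> P_gt0; have [n] := ubnP #|[set p | 0 < H p]|.
elim: n H => // n IHn H; rewrite ltnS; set L := [set p | 0 < H p].
move=> Ln bal H0 [z Hz].
have HL p : p \notin L -> H p = 0.
  by rewrite inE => Hp; apply/eqP; rewrite eq_le H0 andbT leNgt.
have [L0|Ln0] := eqVneq L set0.
  exists (fun=> 0); split=> // [|p].
    rewrite (_ : [set _ | _] = set0) ?tubing0 //.
    by apply/setP => t; rewrite !inE ltxx.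
  by rewrite HL ?L0 ?inE // big1 // => t _; rewrite mul0r.
have [p1 p1L p1min] := exists_argmin H Ln0; pose m := H p1.
have m_gt0 : 0 < m by rewrite inE in p1L.
(* This is the maximum of [H p - m] and 0. As a monotone function of [H] it is balanced with the
   same witnesses, and its support has lost [p1]. *)
pose H' p := if p \in L then H p - m else 0.
have H'mono p q : H p <= H q -> H' p <= H' q.
  rewrite /H'; case: ifP => pL; case: ifP => qL Hpq //.
  - by rewrite lerD2r.
  - by move: pL qL; rewrite !inE => /lt_le_trans/(_ Hpq)->.
  - by rewrite subr_ge0 p1min.
have H'eq p q : H p = H q -> H' p = H' q.
  by move=> Hpq; apply/eqP; rewrite eq_le !H'mono ?Hpq.
have H'L p : 0 < H' p -> p \in L by rewrite /H'; case: ifP; rewrite ?ltxx.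
have [||||lam [lam0 tT Hlam]] := IHn H'.
- apply: leq_trans Ln; apply: proper_card; apply/properP; split.
    by apply/subsetP => p; rewrite inE => /H'L.
  by exists p1; rewrite // inE /H' p1L subrr ltxx.
- move=> x /bal[y [r [yx rx Hyr ymax rmin]]]; exists y, r; split=> //.
  + exact: H'eq.
  + by move=> y' /ymax/H'mono.
  + by move=> r' /rmin/H'mono.
- by move=> p; rewrite /H'; case: ifP => // pL; rewrite subr_ge0 p1min.
- by exists z; rewrite /H' inE Hz ltxx.
have TL t : t \in [set t | 0 < lam t] -> t \subset L.
  rewrite inE => lamt; apply/subsetP => p pt; apply: H'L; rewrite Hlam.
  rewrite (bigD1 t) //= pt mulr1; apply: ltr_wpDr => //.
  by apply: sumr_ge0 => s _; rewrite mulr_ge0.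
have filL : filled L.
  by apply: balanced_support_filled => //; exists p1; rewrite inE in p1L.
have LT : L != setT.
  apply: contra_eqN Hz => /eqP LT.
  by move: (in_setT z); rewrite -LT inE => /lt0r_neq0.
exists (fun t => lam t + m * (t \in components L)%:R); split=> [t||p].
- by rewrite addr_ge0 // mulr_ge0 // ltW.
- have := tubing_adjoin_components P_gt0 tT TL filL LT; congr tubing.
  apply/setP => t; rewrite !inE; case: (t \in components L).
    by rewrite orbT mulr1 ltr_wpDl.
  by rewrite orbF mulr0 addr0.
under eq_bigr => t _ do rewrite mulrDl -mulrA.
rewrite big_split /= -Hlam -mulr_sumr.
under [X in m * X]eq_bigr => t _ do rewrite mulr_natl mulrb.
rewrite -big_mkcond sum_components /H'.
by case: ifP => pL; rewrite ?mulr1 ?subrK // mulr0 addr0 HL ?pL.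
Qed.

(** Completeness of the fan of tubing cones; it lets every linear form on the polytope be analysed
    through one tubing. *)
Lemma function_decomposition h : (0 < #|P|)%N ->
  exists (lam : {set P} -> R) (C : {set P} -> R),
    [/\ forall t, 0 <= lam t, tubing [set t | 0 < lam t]
      & forall p, h p = \sum_t lam t * (p \in t)%:R + C (boundary p)].
Proof.
move=> P_gt0; have [C [bal H0 Hz]] := exists_balanced h P_gt0.
have [lam [lam0 tT Hlam]] := balanced_decomposition P_gt0 bal H0 Hz.
exists lam, (fun B => - C B); split=> // p.
by rewrite -Hlam addrK.
Qed.

End LayerCake.

(** * The pairing of row vectors and convex hulls *)

Section Dot.
Context {R : realType} {d : nat}.
Implicit Types (c x : 'rV[R]_d).
Local Open Scope ring_scope.

Lemma dotvC c x : dotv c x = dotv x c.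
Proof. by apply: eq_bigr => i _; rewrite mulrC. Qed.

Lemma dotv_linear c : linear (dotv c : 'rV[R]_d -> R^o).
Proof.
move=> a x y; rewrite -[RHS]/(a * dotv c x + dotv c y) /dotv mulr_sumr -big_split /=.
by apply: eq_bigr => i _; rewrite !mxE mulrDr mulrCA.
Qed.

HB.instance Definition _ c :=
  GRing.isLinear.Build R 'rV[R]_d R^o *:%R (dotv c) (dotv_linear c).

Lemma dotv_suml (I : finType) (F : I -> 'rV[R]_d) x :
  dotv (\sum_i F i) x = \sum_i dotv (F i) x.
Proof. by rewrite dotvC linear_sum; apply: eq_bigr => i _; apply: dotvC. Qed.

Lemma dotvZr c a x : dotv c (a *: x) = a * dotv c x.
Proof. exact: linearZ. Qed.

Lemma dotvDl c1 c2 x : dotv (c1 + c2) x = dotv c1 x + dotv c2 x.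
Proof. by rewrite dotvC raddfD /= !(dotvC x). Qed.

Lemma dotvZl c a x : dotv (a *: c) x = a * dotv c x.
Proof. by rewrite dotvC dotvZr dotvC. Qed.

Lemma conv_dotv (I : finType) (V : pred I) (f : I -> 'rV[R]_d) c x :
  conv (fun i : 'I_#|V| => f (enum_val i)) x ->
  exists a : 'I_#|V| -> R, [/\ forall i, 0 <= a i, \sum_i a i = 1
    & dotv c x = \sum_i a i * dotv c (f (enum_val i))].
Proof.
case=> a [a0 a1 ->]; exists a; split=> //; rewrite linear_sum.
by apply: eq_bigr => i _; apply: dotvZr.
Qed.

Lemma conv_point k (v : 'I_k -> 'rV[R]_d) i : conv v (v i).
Proof.
exists (fun j => (j == i)%:R); split=> [j||]; rewrite ?ler0n //.
  rewrite (bigD1 i) //= eqxx big1 ?addr0 // => j /negPf->//.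
rewrite (bigD1 i) //= eqxx scale1r big1 ?addr0 // => j /negPf->.
by rewrite scale0r.
Qed.

End Dot.

(** * Points spanning the polytope and their inequalities *)

Section Vertices.
Context {R : realType} {disp : Order.disp_t} {P : finPOrderType disp}.
Variable p0 : P.
Hypothesis p0_min : boundary p0 = set0.
Implicit Types (x y p : P) (t S : {set P}) (T : {set {set P}}) (n : nat).
Local Open Scope ring_scope.

Local Notation vector := 'rV[R]_#|P|.

Definition vec (h : P -> R) : vector := \row_i h (enum_val i).

Definition ind t p : R := (p \in t)%:R.

Definition basis_vec p : vector := delta_mx 0 (enum_rank p).

Lemma dotv_basis h p : dotv (vec h) (basis_vec p) = h p.
Proof.
rewrite /dotv (bigD1 (enum_rank p)) //= !mxE enum_rankK !eqxx mulr1.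
by rewrite big1 ?addr0 // => i /negPf ip; rewrite !mxE ip andbF mulr0.
Qed.

Let choices := ({ffun P -> P} * {ffun P -> P} * {ffun {set P} -> P})%type.
Implicit Types (w : choices).

(* A choice w = (q, r, s) selects q p in the bundle of p, r p in the boundary of p
   and s S in S: arguments for max_{bu(p)} H, min_{bd(p)} H and min_S H.  For
   minimal p, where the boundary is empty, q p is the base point p0 instead.
   Then h |-> h p - h (q p) + (h (r p) - h (q (r p)) + ...), the pairing with
   [path_vec w n p] for n > #|boundary p|, is the linear form selected from
   H p - H p0. *)
Fixpoint path_vec w n p : vector :=
  if n is n'.+1 then
    basis_vec p - basis_vec (w.1.1 p) +
      (if boundary p == set0 then 0 else path_vec w n' (w.1.2 p))
  else 0.

Definition valid w :=
  [forall p, if boundary p == set0 then w.1.1 p == p0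
     else (w.1.1 p \in bundle p) && (w.1.2 p \in boundary p)] &&
  [forall S, tube_or_all S ==> (w.2 S \in S)].

(** The form selected from the sum over [S] of the minima of [H - H p0] on [S]. Depth [#|P|]
    suffices, since every boundary has fewer elements. These points need not all be extreme. *)
Definition vertex w : vector := \sum_(S | tube_or_all S) path_vec w #|P| (w.2 S).

(* The minimum over the polytope of the linear form [ind t], for t a tube <> P. *)
Definition height t : R :=
  \sum_(S : {set P} | tube_or_all S) ((S \subset t)%:R - ind t p0).

Lemma valid_min w p : valid w -> boundary p = set0 -> w.1.1 p = p0.
Proof. by case/andP=> /forallP/(_ p) + _ pmin; rewrite pmin eqxx => /eqP. Qed.

Lemma valid_bundle w p : valid w -> boundary p != set0 -> w.1.1 p \in bundle p.
Proof. by case/andP=> /forallP/(_ p) + _ /negPf pmin; rewrite pmin => /andP[]. Qed.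

Lemma valid_boundary w p :
  valid w -> boundary p != set0 -> w.1.2 p \in boundary p.
Proof. by case/andP=> /forallP/(_ p) + _ /negPf pmin; rewrite pmin => /andP[]. Qed.

Lemma valid_mem w S : valid w -> tube_or_all S -> w.2 S \in S.
Proof. by case/andP=> _ /forallP/(_ S)/implyP. Qed.

Lemma dotv_path_vec w h n p : dotv (vec h) (path_vec w n.+1 p) =
  h p - h (w.1.1 p) +
    (if boundary p == set0 then 0 else dotv (vec h) (path_vec w n (w.1.2 p))).
Proof.
by rewrite raddfD raddfB /= !dotv_basis; case: ifP; rewrite ?raddf0.
Qed.

(** Each [p] has the same boundary as [w.1.1 p], so the two terms cancel at every step of the
    path. *)
Lemma dotv_path_const w (C : {set P} -> R) n p : valid w ->
  dotv (vec (fun p => C (boundary p))) (path_vec w n p) = 0.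
Proof.
move=> vw; elim: n p => [|n IHn] p; first by rewrite raddf0.
rewrite dotv_path_vec IHn if_same addr0.
have [pmin|/(valid_bundle vw)] := eqVneq (boundary p) set0.
  by rewrite (valid_min vw pmin) pmin p0_min subrr.
by rewrite in_bundle => /eqP->; rewrite subrr.
Qed.

Lemma ind_choice_le w t p : valid w -> lower_set t -> boundary p != set0 ->
  ind t (w.1.1 p) <= ind t (w.1.2 p).
Proof.
move=> vw /lower_setP lowt pn0; rewrite /ind ler_nat.
case: (boolP (_ \in t)) => // qt; rewrite (lowt _ _ qt) // ltW //.
have := valid_bundle vw pn0; rewrite in_bundle -in_boundary => /eqP->.
exact: valid_boundary.
Qed.

(** Regrouping the path sum leaves the two end terms plus differences of [ind t] between [w.1.2] and
    [w.1.1], which [ind_choice_le] shows to be nonnegative. *)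
Lemma dotv_path_ge w t n p : valid w -> lower_set t -> (#|boundary p| < n)%N ->
  ind t p - ind t p0 <= dotv (vec (ind t)) (path_vec w n p).
Proof.
move=> vw lowt; elim: n p => // n IHn p pn; rewrite dotv_path_vec.
have [pmin|pn0] := eqVneq (boundary p) set0.
  by rewrite addr0 (valid_min vw pmin).
rewrite -addrA lerD2l -lerBlDl opprK addrC.
apply: le_trans (IHn _ _); first by rewrite lerD2r ind_choice_le.
exact: leq_trans (card_boundary_lt (valid_boundary vw pn0)) pn.
Qed.

(** These are the equality cases of [ind_choice_le] and [ind_choice_ge] for all tubes of [T]. *)
Definition optimal w T := forall t, t \in T ->
  (forall p, boundary p != set0 -> (w.1.1 p \in t) = (w.1.2 p \in t)) /\
  (forall S, tube_or_all S -> (w.2 S \in t) = (S \subset t)).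

Lemma dotv_path_optimal w T t n p : valid w -> optimal w T -> t \in T ->
  (#|boundary p| < n)%N ->
  dotv (vec (ind t)) (path_vec w n p) = ind t p - ind t p0.
Proof.
move=> vw /[apply] -[wt _]; elim: n p => // n IHn p pn; rewrite dotv_path_vec.
have [pmin|pn0] := eqVneq (boundary p) set0.
  by rewrite addr0 (valid_min vw pmin).
rewrite IHn; first by rewrite {2}/ind wt // addrA subrK.
exact: leq_trans (card_boundary_lt (valid_boundary vw pn0)) pn.
Qed.

Lemma card_boundary_max p : (#|boundary p| < #|P|)%N.
Proof.
rewrite -cardsT; apply: proper_card; apply/properP; split; first exact: subsetT.
by exists p; rewrite inE ?ltxx.
Qed.

Lemma ind_choice_ge w t S : valid w -> tube_or_all S ->
  (S \subset t)%:R <= ind t (w.2 S).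
Proof.
move=> vw tS; rewrite ler_nat; case: (boolP (S \subset t)) => // /subsetP->//.
exact: valid_mem.
Qed.

Lemma vertex_ge w t : valid w -> lower_set t ->
  height t <= dotv (vec (ind t)) (vertex w).
Proof.
move=> vw lowt; rewrite raddf_sum; apply: ler_sum => S tS /=.
apply: le_trans (dotv_path_ge vw lowt (card_boundary_max _)).
by rewrite lerD2r ind_choice_ge.
Qed.

Lemma vertex_gt w t S : valid w -> lower_set t -> tube_or_all S ->
  w.2 S \in t -> ~~ (S \subset t) -> height t < dotv (vec (ind t)) (vertex w).
Proof.
move=> vw lowt tS wSt nSt; rewrite raddf_sum /height.
rewrite [ltLHS](bigD1 S) // [ltRHS](bigD1 S) //=; apply: ltr_leD.
  apply: lt_le_trans (dotv_path_ge vw lowt (card_boundary_max _)).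
  by rewrite ltrD2r /ind wSt (negPf nSt) ltr01.
apply: ler_sum => S' /andP[tS' _] /=.
apply: le_trans (dotv_path_ge vw lowt (card_boundary_max _)).
by rewrite lerD2r ind_choice_ge.
Qed.

Lemma vertex_optimal w T t : valid w -> optimal w T -> t \in T ->
  dotv (vec (ind t)) (vertex w) = height t.
Proof.
move=> vw ow tT; rewrite raddf_sum; apply: eq_bigr => S tS /=.
rewrite (dotv_path_optimal vw ow tT (card_boundary_max _)).
by rewrite {1}/ind (ow t tT).2.
Qed.

Lemma vertex_const w (C : {set P} -> R) : valid w ->
  dotv (vec (fun p => C (boundary p))) (vertex w) = 0.
Proof.
by move=> vw; rewrite raddf_sum big1 // => S _; apply: dotv_path_const.
Qed.

Lemma P_gt0 : (0 < #|P|)%N. Proof. by apply/card_gt0P; exists p0. Qed.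

(** The choices come from [tubing_bundle_choice] and [tubing_choice]. Prescribing the one at [S0]
    later gives a vertex tight for [T] but not for a given further tube. *)
Lemma exists_optimal T S0 q0 : tubing T -> q0 \in S0 ->
  (forall t, t \in T -> (q0 \in t) = (S0 \subset t)) ->
  exists w, [/\ valid w, optimal w T & w.2 S0 = q0].
Proof.
move=> tT q0S0 q0T.
have exqr p : exists qr : P * P, if boundary p == set0 then qr.1 = p0 else
    [/\ qr.1 \in bundle p, qr.2 \in boundary p
      & forall t, t \in T -> (qr.1 \in t) = (qr.2 \in t)].
  have [_|pn0] := boolP (boundary p == set0); first by exists (p0, p0).
  by have [q [r ?]] := tubing_bundle_choice tT pn0; exists (q, r).
have exs S : exists q : P, tube_or_all S || (S == S0) ->
    [/\ q \in S, (forall t, t \in T -> (q \in t) = (S \subset t))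
      & S = S0 -> q = q0].
  have [->|SS0] := eqVneq S S0; first by exists q0.
  have [tS|] := boolP (tube_or_all S); last by exists p0.
  have [q qS qT] := tubing_choice P_gt0 tT tS.
  by exists q => _; split=> // SS; rewrite SS eqxx in SS0.
have [f fP] := fin_all_exists exqr; have [s sP] := fin_all_exists exs.
exists ([ffun p => (f p).1], [ffun p => (f p).2], [ffun S => s S]); split.
- apply/andP; split.
    apply/forallP => p; rewrite /= !ffunE.
    by have := fP p; case: ifP => [_ ->//|_ [-> -> _]].
  apply/forallP => S; apply/implyP => tS; rewrite ffunE.
  by have [|->] := sP S; rewrite ?tS.
- move=> t tT'; split=> [p pn0|S tS]; rewrite /= !ffunE.
    by have := fP p; rewrite (negPf pn0) => -[_ _ ->].
  by have [|_ ->] := sP S; rewrite ?tS.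
- by rewrite ffunE; have [|_ _ ->] := sP S0; rewrite ?eqxx ?orbT.
Qed.

End Vertices.

(** * Faces cut out by tubings *)

Section Faces.
Context {R : realType} {disp : Order.disp_t} {P : finPOrderType disp}.
Variable p0 : P.
Hypothesis p0_min : boundary p0 = set0.
Implicit Types (p : P) (t S : {set P}) (T : {set {set P}}) (x : 'rV[R]_#|P|).
Local Open Scope ring_scope.

Definition vertices (i : 'I_#|valid p0|) : 'rV[R]_#|P| := vertex (enum_val i).

Local Notation K := (conv vertices).

Lemma vertices_vertex w : valid p0 w -> exists i, vertices i = vertex w.
Proof.
by move=> vw; exists (enum_rank_in vw w); rewrite /vertices enum_rankK_in.
Qed.

Lemma conv_vertex w : valid p0 w -> K (vertex w).
Proof. by case/vertices_vertex=> i <-; apply: conv_point. Qed.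

Lemma conv_ge t x : tube t -> K x -> height p0 t <= dotv (vec (ind t)) x.
Proof.
move=> /andP[/andP[lowt _] _] /(conv_dotv (vec (ind t)))[a [a0 a1 ->]].
rewrite -[leLHS]mul1r -a1 mulr_suml; apply: ler_sum => i _.
by apply: ler_wpM2l => //; apply: vertex_ge => //; exact: (enum_valP i).
Qed.

Lemma conv_const (C : {set P} -> R) x : K x ->
  dotv (vec (fun p => C (boundary p))) x = 0.
Proof.
move=> /(conv_dotv (vec (fun p => C (boundary p))))[a [_ _ ->]].
rewrite big1 // => i _.
by rewrite (vertex_const p0_min) ?mulr0 //; exact: (enum_valP i).
Qed.

Definition tight T x := forall t, t \in T -> dotv (vec (ind t)) x = height p0 t.

Lemma tight_vertex T : tubing T -> exists2 w, valid p0 w & tight T (vertex w).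
Proof.
move=> tT; have [q qT] := tubing_uncovered tT.
have [||w [vw ow _]] := @exists_optimal _ _ p0 T setT q tT; first by rewrite inE.
  move=> t tT'; rewrite (negPf (qT t tT')) subTset.
  by rewrite (negPf (tubing_neqT tT tT')).
by exists w => // t; apply: vertex_optimal ow.
Qed.

(** For [t0] in [T'] but not in [T], the choice from [tubing_separation] extends to a vertex that is
    tight for [T] but lies strictly above the bound for [t0]. *)
Lemma tight_sub T T' : tubing T -> tubing T' ->
  (forall x, K x -> tight T x -> tight T' x) -> T' \subset T.
Proof.
move=> tT tT' sub; apply/subsetP => t0 t0T'; apply/negPn/negP => t0T.
have tt0 := tubing_tube tT' t0T'.
have [S [q [tS qS qT qt0 nSt0]]] :=
  tubing_separation (P_gt0 p0) tT tt0 (tubing_neqT tT' t0T') t0T.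
have [w [vw ow wS]] := exists_optimal p0 tT qS qT.
have lowt0 : lower_set t0 by case/andP: tt0 => /andP[].
have := @vertex_gt R _ _ _ w t0 S vw lowt0 tS; rewrite wS => /(_ qt0 nSt0).
rewrite (sub _ (conv_vertex vw)) ?ltxx // => t tT0.
exact: vertex_optimal ow tT0.
Qed.

Lemma vec_decomposition (lam : {set P} -> R) C h :
  (forall p, h p = \sum_t lam t * ind t p + C (boundary p)) ->
  vec h = \sum_t lam t *: vec (ind t) + vec (fun p => C (boundary p)).
Proof.
move=> hE; apply/rowP => i; rewrite !mxE hE summxE; congr (_ + _).
by apply: eq_bigr => t _; rewrite !mxE.
Qed.

(** The inequalities [conv_ge] are added with weights [lam t]; the bundle-constant term vanishes on
    the polytope, and equality in the sum means equality wherever the weight is positive. *)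
Lemma weighted_leif (lam : {set P} -> R) (C : {set P} -> R) x :
  (forall t, 0 <= lam t) -> tubing [set t | 0 < lam t] -> K x ->
  \sum_t lam t * height p0 t <=
    dotv (\sum_t lam t *: vec (ind t) + vec (fun p => C (boundary p))) x
  ?= iff [forall t, (0 < lam t) ==> (dotv (vec (ind t)) x == height p0 t)].
Proof.
move=> lam0 tT Kx; rewrite dotvDl conv_const // addr0 dotv_suml.
apply: leif_sum => t _; rewrite dotvZl.
have := lam0 t; rewrite le0r => /predU1P[->|lamt].
  by rewrite !mul0r ltxx; apply/leif_refl.
rewrite lamt (mono_leif (ler_pM2l lamt)) eq_sym; apply/leif_eq.
by rewrite conv_ge // (tubing_tube tT) // inE.
Qed.

Lemma tight_forallP (lam : {set P} -> R) x :
  reflect (tight [set t | 0 < lam t] x)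
    [forall t, (0 < lam t) ==> (dotv (vec (ind t)) x == height p0 t)].
Proof.
apply: (iffP forallP) => [H t|H t]; first by rewrite inE => /(implyP (H t))/eqP.
by apply/implyP => lamt; apply/eqP/H; rewrite inE.
Qed.

(** A vertex tight for the whole tubing attains the bound of [weighted_leif], so [b] is that bound
    and its equality case describes the minimizers. *)
Lemma minimal_tight (lam : {set P} -> R) C h b :
  (forall t, 0 <= lam t) -> tubing [set t | 0 < lam t] ->
  (forall p, h p = \sum_t lam t * ind t p + C (boundary p)) ->
  (forall x, K x -> b <= dotv (vec h) x) ->
  (exists2 x, K x & dotv (vec h) x = b) ->
  forall x, K x -> dotv (vec h) x = b <-> tight [set t | 0 < lam t] x.
Proof.
move=> lam0 tT /vec_decomposition hE hb [y Ky yb] x Kx.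
have leif_x z (Kz : K z) := weighted_leif C lam0 tT Kz.
rewrite -hE in leif_x.
have [w vw ww] := tight_vertex tT.
have bE : b = \sum_t lam t * height p0 t.
  apply/eqP; rewrite eq_le -{2}yb (leif_x y Ky) andbT.
  have [_] := leif_x _ (conv_vertex vw).
  by rewrite (introT (tight_forallP _ _)) => // /eqP->; apply/hb/conv_vertex.
have [_] := leif_x x Kx; rewrite -bE eq_sym => eqb.
split=> [xb|tx]; first by apply/tight_forallP; rewrite -eqb xb.
by apply/eqP; rewrite eqb; apply/tight_forallP.
Qed.

Lemma tight_supporting T : tubing T ->
  exists c b, (forall x, K x -> dotv c x <= b) /\
    (forall x, K x -> dotv c x = b <-> tight T x).
Proof.
move=> tT; pose lam t : R := (t \in T)%:R.
have TE : [set t | 0 < lam t] = T.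
  by apply/setP => t; rewrite inE /lam ltr0n lt0b.
have lam0 t : 0 <= lam t by rewrite ler0n.
pose h p := \sum_t lam t * ind t p + (fun=> 0) (boundary p).
have hE := vec_decomposition (fun p => erefl (h p)).
have leif_x tT1 x : K x -> _ := @weighted_leif lam (fun=> 0) x lam0 tT1.
rewrite TE -hE in leif_x.
(* The sum of the indicators of [T] is minimal exactly where each of them is; the sign changes
   because [face] is defined by a maximum. *)
exists (- vec h), (- \sum_t lam t * height p0 t); split=> x Kx;
  rewrite dotvC raddfN /= dotvC; have [le_x eq_x] := leif_x tT x Kx.
  by rewrite lerN2.
split=> [/oppr_inj/esym/eqP|tx]; first by rewrite eq_x => /tight_forallP; rewrite TE.
by congr (- _); apply/esym/eqP; rewrite eq_x; apply/tight_forallP; rewrite TE.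
Qed.

(** A form constant on the polytope is minimal everywhere, so every point is tight for its tubing.
    By [tight_sub] against the empty tubing, that tubing is empty and only the bundle-constant term
    remains. *)
Lemma constant_functional h : 
  (forall x y, K x -> K y -> dotv (vec h) x = dotv (vec h) y) ->
  exists C : {set P} -> R, forall p, h p = C (boundary p).
Proof.
move=> hconst.
have [lam [C [lam0 tT hE]]] := function_decomposition h (P_gt0 p0).
have [w vw _] := tight_vertex tT.
have Kw := conv_vertex vw.
have tightP := @minimal_tight lam C h (dotv (vec h) (vertex w)) lam0 tT hE.
have T0 : [set t | 0 < lam t] \subset set0.
  apply: tight_sub => // [|x Kx _]; first exact: tubing0 (P_gt0 p0).
  apply/tightP => //; last exact: hconst.
  - by move=> y Ky; rewrite (hconst _ _ Ky Kw).
  - by exists (vertex w).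
exists C => p; rewrite hE big1 ?add0r // => t _.
have : t \notin [set t | 0 < lam t].
  by move: T0; rewrite subset0 => /eqP->; rewrite inE.
by rewrite inE -leNgt => lamt; rewrite (@le_anti _ R (lam t) 0) ?mul0r // lamt lam0.
Qed.

End Faces.

(** * The bundle space and its dimension *)

Section Dimension.
Context {R : realType} {disp : Order.disp_t} {P : finPOrderType disp}.
Implicit Types (p : P) (x : 'rV[R]_#|P|).
Local Open Scope ring_scope.

Lemma vec_coord (c : 'rV[R]_#|P|) : vec (fun p => c 0 (enum_rank p)) = c.
Proof. by apply/rowP => i; rewrite mxE enum_valK. Qed.

Lemma dotv_mulmx d (c x : 'rV[R]_d) : dotv c x = (x *m c^T) 0 0.
Proof. by rewrite dotvC mxE; apply: eq_bigr => i _; rewrite mxE. Qed.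

Definition bundle_mx : 'M[R]_(#|P|, #|bundles P|) :=
  \matrix_(i, j) ((enum_val i : P) \in (enum_val j : {set P}))%:R.

Lemma bundle_index_ex (j : 'I_#|bundles P|) : exists p, enum_val j = bundle p.
Proof. by have /imsetP[p _ ->] := enum_valP j; exists p. Qed.

Lemma bundle_index p : exists j : 'I_#|bundles P|, enum_val j = bundle p.
Proof.
have pB : bundle p \in bundles P by apply: imset_f.
by exists (enum_rank_in pB (bundle p)); rewrite enum_rankK_in.
Qed.

Lemma mem_bundle_index (j : 'I_#|bundles P|) p :
  (p \in (enum_val j : {set P})) = (enum_val j == bundle p).
Proof.
have [y ->] := bundle_index_ex j; apply/idP/eqP => [|->]; last exact: bundle_id.
by rewrite in_bundle /bundle => /eqP->.
Qed.

Lemma bundle_mx_right_inverse :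
  exists A : 'M[R]_(#|bundles P|, #|P|), A *m bundle_mx = 1%:M.
Proof.
have [f fP] := fin_all_exists bundle_index_ex.
(* Each row of the inverse selects one representative [f j] of a bundle. *)
exists (\matrix_(j, i) (i == enum_rank (f j))%:R).
apply/matrixP => j k; rewrite mxE (bigD1 (enum_rank (f j))) //= !mxE eqxx mul1r.
rewrite enum_rankK mem_bundle_index -fP (inj_eq enum_val_inj) eq_sym.
by rewrite big1 ?addr0 // => i /negPf ij; rewrite mxE ij mul0r.
Qed.

(** A function constant on bundles is a combination of the columns of [bundle_mx]. *)
Lemma dotv_bundle_const (C : {set P} -> R) x : x *m bundle_mx = 0 ->
  dotv (vec (fun p => C (boundary p))) x = 0.
Proof.
move=> xB; have [f fP] := fin_all_exists bundle_index_ex.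
suff -> : vec (fun p => C (boundary p)) = (\row_j C (boundary (f j))) *m bundle_mx^T.
  by rewrite dotv_mulmx trmx_mul trmxK mulmxA xB mul0mx mxE.
apply/rowP => i; rewrite !mxE; have [j jP] := bundle_index (enum_val i).
rewrite (bigD1 j) //= !mxE mem_bundle_index jP eqxx mulr1 big1 ?addr0.
  congr C; apply/eqP; rewrite -in_bundle.
  have := bundle_id (f j); rewrite -fP jP in_bundle eq_sym => fj.
  by rewrite in_bundle.
move=> k kj; rewrite !mxE mem_bundle_index -jP (inj_eq enum_val_inj).
by rewrite (negPf kj) mulr0.
Qed.

Lemma bundle_mx_kernel x :
  (forall C : {set P} -> R, dotv (vec (fun p => C (boundary p))) x = 0) ->
  x *m bundle_mx = 0.
Proof.
move=> xC; apply/rowP => j; rewrite [RHS]mxE.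
have [y jy] := bundle_index_ex j; rewrite -(xC (fun B => (B == boundary y)%:R)).
rewrite dotv_mulmx !mxE; apply: eq_bigr => i _.
by rewrite !mxE jy in_bundle.
Qed.

(** The vectors whose coordinates sum to zero over every bundle. *)
Definition bundle_space : {vspace 'rV[R]_#|P|} := lker (linfun (mulmxr bundle_mx)).

Lemma mem_bundle_space x : (x \in bundle_space) = (x *m bundle_mx == 0).
Proof. by rewrite memv_ker lfunE. Qed.

Lemma dim_bundle_space : \dim bundle_space = (#|P| - #|bundles P|)%N.
Proof.
have := limg_ker_dim (linfun (mulmxr bundle_mx : 'rV[R]__ -> 'rV[R]__)) fullv.
have -> : limg (linfun (mulmxr bundle_mx : 'rV[R]__ -> 'rV[R]__)) = fullv.
  apply/eqP; rewrite eqEsubv subvf /=; apply/subvP => y _.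
  have [A AB] := bundle_mx_right_inverse.
  have -> : y = linfun (mulmxr bundle_mx) (y *m A).
    by rewrite lfunE /= -mulmxA AB mulmx1.
  exact: memv_img (memvf _).
have dim_rV k : dim 'rV[R]_k = k by rewrite dim_matrix; apply: mul1n.
by rewrite capfv !dimvf !dim_rV => /(canRL (addnK _)).
Qed.

End Dimension.

(** * The affine hull of the polytope *)

Section AffineHull.
Context {R : realType} {disp : Order.disp_t} {P : finPOrderType disp}.
Variable p0 : P.
Hypothesis p0_min : boundary p0 = set0.
Local Open Scope ring_scope.

Local Notation vtx := (@vertices R _ P p0).
Local Notation K := (conv vtx).

Lemma conv_bundle_mx x : K x -> x *m bundle_mx = 0.
Proof. by move=> Kx; apply: bundle_mx_kernel => C; apply: conv_const Kx. Qed.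

Lemma aff_conv_sub x0 x : K x0 -> aff K x -> x - x0 \in bundle_space.
Proof.
move=> Kx0 [k [v [a [Kv _ ->]]]]; rewrite mem_bundle_space mulmxBl mulmx_suml.
rewrite (conv_bundle_mx Kx0) subr0 big1 // => i _.
by rewrite -scalemxAl conv_bundle_mx ?scaler0.
Qed.

(* A functional vanishing on the differences of vertices is constant on K, hence
   constant on bundles, hence vanishes on the bundle space. *)
Lemma bundle_space_sub_aff i0 x :
  x - vtx i0 \in bundle_space -> aff K x.
Proof.
move=> xU; pose D : 'M[R]_(_, _) := \matrix_i (vtx i - vtx i0 ).
have /submxP[s sE] : (x - vtx i0 <= D)%MS.
  rewrite submxE; apply/eqP/rowP => k; rewrite [RHS]mxE.
  (* Each column of the cokernel is read as a functional vanishing on the rows of [D], the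
     differences of vertices. *)
  pose c : 'rV[R]_#|P| := (col k (cokermx D))^T.
  have cE (y : 'rV[R]_#|P|) : dotv c y = (y *m cokermx D) 0 k.
    by rewrite dotv_mulmx trmxK !mxE; apply: eq_bigr => j _; rewrite !mxE.
  have cv i : dotv c (vtx i) = dotv c (vtx i0).
    apply/eqP; rewrite -subr_eq0 -raddfB /= cE.
    have -> : vtx i - vtx i0 = row i D by rewrite rowK.
    by rewrite -row_mul mulmx_coker !mxE.
  have cK y : K y -> dotv c y = dotv c (vtx i0).
    move=> /(conv_dotv c)[a [_ a1 ->]].
    by under eq_bigr do rewrite cv; rewrite -mulr_suml a1 mul1r.
  have [|C hC] := @constant_functional R _ P p0 p0_min (fun p => c 0 (enum_rank p)).
    by move=> y z Ky Kz; rewrite vec_coord !cK.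
  rewrite -cE -(vec_coord c).
  rewrite (_ : vec _ = vec (fun p => C (boundary p))); last first.
    by apply/rowP => i; rewrite mxE [RHS]mxE hC.
  by apply: dotv_bundle_const; apply/eqP; rewrite -mem_bundle_space.
(* The row [s] writes [x - vtx i0] in terms of the differences; [vtx i0] receives the remainder that
   makes the coefficients sum to 1. *)
exists _, vtx, (fun i => s 0 i + (i == i0)%:R * (1 - \sum_j s 0 j)).
split; first by move=> i; apply: conv_point.
  rewrite big_split /= [X in _ + X](bigD1 i0) //= eqxx mul1r.
  rewrite [X in _ + (_ + X)]big1; first by rewrite addr0 addrC subrK.
  by move=> i /negPf->; rewrite mul0r.
under eq_bigr do rewrite scalerDl.
rewrite big_split /= [X in _ + X](bigD1 i0) //= eqxx mul1r [X in _ + (_ + X)]big1.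
  rewrite addr0 scalerBl scale1r addrCA scaler_suml -sumrB.
  apply/eqP; rewrite addrC -subr_eq sE mulmx_sum_row; apply/eqP.
  by apply: eq_bigr => i _; rewrite rowK scalerBr.
by move=> i /negPf->; rewrite mul0r scale0r.
Qed.

End AffineHull.

From mathcomp Require Import boolp classical_sets.

(** * The isomorphism of face posets *)

Section Main.
Context {R : realType} {disp : Order.disp_t} {P : finPOrderType disp}.
Variable p0 : P.
Hypothesis p0_min : boundary p0 = finset.set0.
Local Open Scope ring_scope.

Local Notation K := (conv (@vertices R _ P p0)).

Lemma affine_dim_conv : affine_dim K (#|P| - #|bundles P|)%N.
Proof.
have [w vw _] := @tight_vertex R _ P p0 _ (tubing0 (P_gt0 p0)).
have [i0 i0E] := vertices_vertex (R := R) vw.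
exists (vertices i0), bundle_space; split; first exact: dim_bundle_space.
apply/seteqP; split=> x; last exact: bundle_space_sub_aff.
exact/aff_conv_sub/conv_point.
Qed.

Definition tight_face (T : {set {set P}}) : set 'rV[R]_#|P| :=
  [set x | K x /\ tight p0 T x].

Lemma tight_face_nonempty (T : tubings P) : nonempty_face K (tight_face (sval T)).
Proof.
case: T => T tT; split.
  have [c [b [leb eqb]]] := @tight_supporting R _ P p0 p0_min T tT.
  exists c, b; split=> //; apply/seteqP; split=> x /= -[Kx].
    by move/(eqb x Kx).
  by move/(eqb x Kx).
have [w vw wT] := @tight_vertex R _ P p0 T tT.
by exists (vertex w); split=> //; apply: conv_vertex.
Qed.

(** Faces maximize and tubings describe minimizers, so the functional is negated;
    [function_decomposition] then yields the tubing, and [minimal_tight] identifies the face. *)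
Lemma nonempty_face_tight (F : set 'rV[R]_#|P|) : nonempty_face K F ->
  exists T : tubings P, F = tight_face (sval T).
Proof.
case=> -[c [b [leb ->]]] [y [Ky yb]]; pose h p := - c 0 (enum_rank p).
have hE x : dotv (vec h) x = - dotv c x.
  have -> : vec h = - c by apply/rowP => i; rewrite !mxE /h enum_valK.
  by rewrite dotvC raddfN /= dotvC.
have [lam [C [lam0 tT hD]]] := function_decomposition h (P_gt0 p0).
have tightP x : K x -> dotv c x = b <-> tight p0 [set t | 0 < lam t]%SET x.
  move=> Kx; rewrite -(minimal_tight p0_min (b := - b) lam0 tT hD) //.
  - by rewrite hE; split=> [->//|/oppr_inj].
  - by move=> z Kz; rewrite hE lerN2 leb.
  - by exists y; rewrite // hE yb.
exists (exist (fun T => is_true (tubing T)) _ tT); apply/seteqP.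
by split=> x /= -[Kx /(tightP x Kx)].
Qed.

Lemma tight_face_le (S T : tubings P) :
  tubing_le S T <-> (tight_face (sval S) `<=` tight_face (sval T))%classic.
Proof.
split=> [ST x [Kx xS]|sub].
  by split=> // t tT; apply: xS; exact: (fintype.subsetP ST).
apply: (@tight_sub R _ P p0); [exact: (svalP S)|exact: (svalP T)|].
by move=> x Kx xS; have [] := sub x (conj Kx xS).
Qed.

Lemma tight_face_iso : poset_iso (@tubing_le disp P) (@face_le R _ K).
Proof.
pose f T : nonempty_faces K := exist _ (tight_face (sval T)) (tight_face_nonempty T).
have f_le S T : tubing_le S T <-> face_le (f S) (f T) by exact: tight_face_le.
have f_inj : injective f.
  move=> S T fST; apply/val_inj/eqP; rewrite finset.eqEsubset.
  by apply/andP; split; apply/f_le; rewrite fST => x.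
have f_surj F : exists T, f T = F.
  case: F => F nF; have [T FT] := nonempty_face_tight nF.
  by exists T; apply: eq_exist.
have [g gP] := choice f_surj.
by exists f; split=> //; exists g => // T; apply: f_inj; rewrite gP.
Qed.

End Main.

Theorem theorem2p4 (R : realType) (disp : Order.disp_t)
    (P : finPOrderType disp) (n b : nat)
    (P_gt0 : (0 < #|P|)%N) (cardP : #|P| = n) (card_bundles : #|bundles P| = b) :
  exists (d : nat) (K : set 'rV[R]_d),
    [/\ polytope K,
        affine_dim K (n - b)%N
      & poset_iso (@tubing_le disp P) (@face_le R d K)].
Proof.
have [p0 p0_min] := exists_minimal P_gt0.
exists #|P|, (conv (@vertices R _ P p0)); split.
- by exists #|valid p0|, (@vertices R _ P p0).
- by rewrite -cardP -card_bundles; apply: affine_dim_conv.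
- exact: tight_face_iso.
Qed.
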